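(* Let $d\in\{1,2,3\}$, $\Omega=(0,1)^d$, $V_0=H^1_0(\Omega)$, $f\in L^2(\Omega)$, let $A_\epsilon\in L^\infty(\Omega,\mathbb{M}^{d\times d}_{\mathrm{sym}})$ and let $A_0$ be a $d\times d$ matrix function on $\Omega$ such that, for all $\zeta\in\mathbb{R}^d$ and $x\in\Omega$, $$\lambda^\epsilon_\ominus|\zeta|^2\le A_\epsilon(x)\zeta\cdot\zeta\le\lambda^\epsilon_\oplus|\zeta|^2,\qquad \lambda^0_\ominus|\zeta|^2\le A_0\zeta\cdot\zeta\le\lambda^0_\oplus|\zeta|^2$$ with positive constants. Let $\lambda_1,c_\oplus>0$ be constants such that $\lambda_1A_0\zeta\cdot\zeta\le A_\epsilon\zeta\cdot\zeta$ and $A_\epsilon A_0^{-1}A_\epsilon\zeta\cdot\zeta\le c_\oplus A_0\zeta\cdot\zeta$ for all $\zeta\in\mathbb{R}^d$ and $x\in\Omega$; let $0<\rho<2\lambda_1/c_\oplus$ and $q=q(\rho)=\sqrt{1-2\rho\lambda_1+\rho^2c_\oplus}$. Let $u_\epsilon\in V_0$ solve $\int_\Omega A_\epsilon\nabla u_\epsilon\cdot\nabla w\,dx=\int_\Omega fw\,dx$ for all $w\in V_0$. Let $u_{k,h}\in V_0$ be the approximation computed at step $k$ on a mesh $\mathcal{T}^k_h$, and let $u_{k+1,h}\in V_0$ be a function computed on a mesh $\mathcal{T}^{k+1}_h$ (which may coincide with $\mathcal{T}^k_h$ or be a new one), used in place of the exact solution $u\in V_0$ of $$\int_\Omega A_0\nabla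 u\cdot\nabla w\,dx=\int_\Omega A_0\nabla u_{k,h}\cdot\nabla w\,dx-\rho\int_\Omega(A_\epsilon\nabla u_{k,h}\cdot\nabla w-fw)\,dx\quad\forall w\in V_0.$$ Put $\eta_{k+1}=u_{k+1,h}-u_{k,h}$. Then for every $y\in H(\Omega,\mathrm{div})$ $$\|u_{k,h}-u_\epsilon\|_0\le\frac{1}{1-q}\Big(\|\eta_{k+1}\|_0+\mathcal{M}_\oplus(u_{k+1,h},u_{k,h},y)\Big),$$ $$\|u_{k,h}-u_\epsilon\|_0\ge\frac{1}{1+q}\Big(\|\eta_{k+1}\|_0-\mathcal{M}_\oplus(u_{k+1,h},u_{k,h},y)\Big).$$
   Context: $\mathbb{M}^{d\times d}_{\mathrm{sym}}$ denotes the set of real symmetric $d\times d$ matrices. Notation: $\|w\|_0=\left(\int_\Omega A_0\nabla w\cdot\nabla w\,dx\right)^{1/2}$; $\|\cdot\|$ without subscript is the $L^2(\Omega)$ norm; $H(\Omega,\mathrm{div})$ is the space of vector fields in $L^2(\Omega,\mathbb{R}^d)$ with divergence in $L^2(\Omega)$; $C_F$ is the Friedrichs constant of $\Omega$, i.e. $\|w\|\le C_F\|\nabla w\|$ for all $w\in H^1_0(\Omega)$. For $\widetilde u,v\in V_0$ and $y\in H(\Omega,\mathrm{div})$, with $\eta=\widetilde u-v$ and $\tau=y-\rho A_\epsilon\nabla v$, $$\mathcal{M}_\oplus(\widetilde u,v,y)=\left(\int_\Omega\big(A_0\nabla\eta\cdot\nabla\eta+A_0^{-1}\tau\cdot\tau-2\nabla\eta\cdot\tau\big)dx\right)^{1/2}+\frac{C_F}{\lambda^0_\ominus}\,\|\mathrm{div}\,y+\rho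 f\| .$$
   Formalization: The formal theorem additionally assumes that the lower ellipticity constant of A_0 satisfies λ^0_⊖ ≤ 1 and that A_0 is symmetric and measurable; the printed estimates fail for λ^0_⊖ > 1 (weight C_F/λ^0_⊖ lacks a square root) and for non-symmetric A_0. *)

(* Defs.v *)
From HB Require Import structures.
From mathcomp Require Import all_boot all_order all_algebra.
From mathcomp Require Import all_classical all_reals all_analysis.

Set Implicit Arguments.
Unset Strict Implicit.
Unset Printing Implicit Defensive.

Import Order.TTheory GRing.Theory Num.Theory numFieldNormedType.Exports.

Local Open Scope classical_set_scope.
Local Open Scope ring_scope.

(* Points of R^n are row vectors, which carry the topology and the directional
   derivatives of the library.  They are given here the sigma-algebra generated
   by the coordinate functions, i.e. the Borel sigma-algebra. *)
Section measurable_rV.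
Context {R : realType} (n : nat).

Definition rV_coord (i : 'I_n) (x : 'rV[R]_n) : R := x ord0 i.

Let rV_set0 : g_sigma_preimage rV_coord set0.
Proof. exact: sigma_algebra0. Qed.

Let rV_setC A : g_sigma_preimage rV_coord A -> g_sigma_preimage rV_coord (~` A).
Proof. exact: sigma_algebraC. Qed.

Let rV_bigcup (F : (set _)^nat) : (forall i, g_sigma_preimage rV_coord (F i)) ->
  g_sigma_preimage rV_coord (\bigcup_i (F i)).
Proof. exact: sigma_algebra_bigcup. Qed.

HB.instance Definition _ :=
  @isMeasurable.Build (measure_tuple_display default_measure_display)
    'rV[R]_n (g_sigma_preimage rV_coord) rV_set0 rV_setC rV_bigcup.

Lemma measurable_rV_coord (i : 'I_n) : measurable_fun [set: 'rV[R]_n] (rV_coord i).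
Proof.
move=> _ Y mY; rewrite setTI; apply: sub_sigma_algebra => /=.
rewrite -bigcup_seq/=; exists i => /=; first by rewrite mem_index_enum.
by exists Y => //; rewrite setTI.
Qed.

Lemma measurable_fun_rV d (T : measurableType d) (f : T -> 'rV[R]_n) :
  (forall i, measurable_fun setT (fun t => f t ord0 i)) -> measurable_fun setT f.
Proof.
move=> mf _ Y; rewrite setTI.
suff : @measurable _ 'rV[R]_n `<=` (fun A => measurable (f @^-1` A)) by apply.
apply: smallest_sub.
  split => /= [|A mA|F mF]; first by rewrite preimage_set0.
    by rewrite setTD preimage_setC; exact: measurableC.
  by rewrite preimage_bigcup; exact: bigcup_measurable.
move=> A; rewrite -bigcup_seq => -[i /= _] [B mB <-]; rewrite setTI.
by have := mf i measurableT B mB; rewrite setTI.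
Qed.

End measurable_rV.

Lemma product_sigma_finite {R : realType} d1 d2 (T1 : measurableType d1)
    (T2 : measurableType d2) (m1 : {sigma_finite_measure set T1 -> \bar R})
    (m2 : {sigma_finite_measure set T2 -> \bar R}) :
  sigma_finite setT (m1 \x m2)%E.
Proof.
have /sigma_finiteP[F [TF ndF Foo]] := sigma_finiteT m1.
have /sigma_finiteP[G [TG ndG Goo]] := sigma_finiteT m2.
exists (fun n => F n `*` G n).
  rewrite -setXTT TF TG predeqE => -[x y]; split.
    move=> [/= [n _ Fnx] [k _ Gky]]; exists (maxn n k) => //; split.
    - by move: x Fnx; exact/subsetPset/ndF/leq_maxl.
    - by move: y Gky; exact/subsetPset/ndG/leq_maxr.
  by move=> [n _ []/= ? ?]; split; exists n.
move=> k; have [? ?] := Foo k; have [? ?] := Goo k.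
split; first exact: measurableX.
by rewrite product_measure1E// lte_mul_pinfty// ge0_fin_numE.
Qed.

Section lebesgue_rV.
Context {R : realType}.

Definition cons_rV n (p : measurableTypeR R * 'rV[R]_n) : 'rV[R]_n.+1 :=
  \row_i (if unlift ord0 i is Some j then p.2 ord0 j else p.1).

Definition uncons_rV n (x : 'rV[R]_n.+1) : measurableTypeR R * 'rV[R]_n :=
  (x ord0 ord0, \row_j x ord0 (lift ord0 j)).

Lemma cons_rVK n : cancel (@cons_rV n) (@uncons_rV n).
Proof.
case=> a v; rewrite /uncons_rV /cons_rV; congr pair; first by rewrite mxE unlift_none.
by apply/rowP => j; rewrite !mxE liftK.
Qed.

Lemma measurable_cons_rV n : measurable_fun setT (@cons_rV n).
Proof.
apply: measurable_fun_rV => i; case: (unliftP ord0 i) => [j|] ->.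
  rewrite (_ : (fun _ => _) = @rV_coord R n j \o snd); last first.
    by apply/funext => p /=; rewrite mxE liftK.
  by apply: measurableT_comp => //; exact: measurable_rV_coord.
rewrite (_ : (fun _ => _) = fst); first exact: measurable_fst.
by apply/funext => p /=; rewrite mxE unlift_none.
Qed.

Lemma measurable_uncons_rV n : measurable_fun setT (@uncons_rV n).
Proof.
apply: measurable_fun_pair => /=; first exact: (@measurable_rV_coord R n.+1 ord0).
apply: measurable_fun_rV => j.
rewrite (_ : (fun _ => _) = @rV_coord R n.+1 (lift ord0 j)).
  exact: measurable_rV_coord.
by apply/funext => x; rewrite mxE.
Qed.

Section step.
Variables (n : nat) (mu : {sigma_finite_measure set 'rV[R]_n -> \bar R}).

Definition lebesgue_rV_step : set 'rV[R]_n.+1 -> \bar R :=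
  pushforward (lebesgue_measure \x mu)%E (@cons_rV n).

Let step0 : lebesgue_rV_step set0 = 0%E.
Proof. by rewrite /lebesgue_rV_step /pushforward preimage_set0 measure0. Qed.

Let step_ge0 A : (0 <= lebesgue_rV_step A)%E.
Proof. by rewrite /lebesgue_rV_step /pushforward; exact: measure_ge0. Qed.

Let step_sigma_additive : semi_sigma_additive lebesgue_rV_step.
Proof.
have mp A : measurable A -> measurable (@cons_rV n @^-1` A).
  by move=> mA; rewrite -[X in measurable X]setTI; exact: measurable_cons_rV.
move=> F mF tF mUF; rewrite /lebesgue_rV_step /pushforward preimage_bigcup.
apply: measure_semi_sigma_additive.
- by move=> k; exact: mp.
- apply/trivIsetP => /= i j _ _ ij; rewrite -preimage_setI.
  by move/trivIsetP : tF => /(_ _ _ _ _ ij) ->//; rewrite preimage_set0.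
- by rewrite -preimage_bigcup; exact: mp.
Qed.

HB.instance Definition _ := isMeasure.Build _ _ _ lebesgue_rV_step
  step0 step_ge0 step_sigma_additive.

Let step_sigma_finite : sigma_finite setT lebesgue_rV_step.
Proof.
have [F FT mF] : sigma_finite setT (lebesgue_measure \x mu)%E.
  exact: product_sigma_finite.
exists (fun k => @uncons_rV n @^-1` F k) => [|k].
  by rewrite -preimage_bigcup -FT preimage_setT.
have [mFk Fk] := mF k; split.
  by rewrite -[X in measurable X]setTI; exact: measurable_uncons_rV.
rewrite /lebesgue_rV_step /pushforward -comp_preimage.
rewrite (_ : _ \o _ = id) ?preimage_id//.
by apply/funext => p /=; rewrite cons_rVK.
Qed.

HB.instance Definition _ := Measure_isSigmaFinite.Build _ _ _ lebesgue_rV_step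
  step_sigma_finite.

End step.

(* Lebesgue measure on R^n, by iterated products of the measure on R. *)
Fixpoint lebesgue_rV n : {sigma_finite_measure set 'rV[R]_n -> \bar R} :=
  if n is m.+1 return {sigma_finite_measure set 'rV[R]_n -> \bar R}
  then lebesgue_rV_step (lebesgue_rV m) else \d_(0 : 'rV[R]_0).

End lebesgue_rV.

Section sobolev.
Context {R : realType} {d : nat}.
Implicit Types (f phi : 'rV[R]_d -> R) (F : 'rV[R]_d -> 'cV[R]_d).

Definition dot (a b : 'cV[R]_d) : R := \sum_i a i ord0 * b i ord0.

(* Omega = (0,1)^d. *)
Definition cube : set 'rV[R]_d := [set x | forall i, 0 < x ord0 i < 1].

(* Functions on Omega are total functions of which only the values on Omega
   matter; elements of L^2 are represented by Borel functions. *)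
Definition L2 f : Prop :=
  measurable_fun cube f /\
  (lebesgue_rV d).-integrable cube (fun x => (f x ^+ 2)%:E).

Definition L2vec F : Prop := forall i, L2 (fun x => F x i ord0).

Definition norm2 f : R :=
  Num.sqrt (\int[lebesgue_rV d]_(x in cube) (f x ^+ 2)).

Definition norm2vec F : R :=
  Num.sqrt (\int[lebesgue_rV d]_(x in cube) dot (F x) (F x)).

Definition partial (i : 'I_d) phi : 'rV[R]_d -> R :=
  fun x => 'D_(delta_mx ord0 i) phi x.

Definition gradient phi : 'rV[R]_d -> 'cV[R]_d :=
  fun x => \col_i partial i phi x.

Fixpoint Cdiff (k : nat) phi : Prop :=
  continuous phi /\
  if k is m.+1 then
    forall i, (forall x, derivable phi x (delta_mx ord0 i)) /\
      Cdiff m (partial i phi)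
  else True.

(* C_c^infty(Omega) *)
Definition test_function phi : Prop :=
  [/\ forall k, Cdiff k phi,
      compact (closure [set x | phi x != 0]) &
      closure [set x | phi x != 0] `<=` cube].

Definition is_weak_gradient f F : Prop :=
  forall phi, test_function phi -> forall i,
    \int[lebesgue_rV d]_(x in cube) (f x * partial i phi x) =
    - \int[lebesgue_rV d]_(x in cube) (F x i ord0 * phi x).

Definition is_weak_divergence F f : Prop :=
  forall phi, test_function phi ->
    \int[lebesgue_rV d]_(x in cube) dot (F x) (gradient phi x) =
    - \int[lebesgue_rV d]_(x in cube) (f x * phi x).

(* A weak gradient is unique only up to null sets, so an element w of H^1 is a
   pair whose first component is the function and whose second component is a
   representative of its weak gradient; in particular w - v is formed
   componentwise.  Elements of H(Omega, div) are likewise pairs (y, div y). *)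
Definition sobolev : Type :=
  (('rV[R]_d -> R) * ('rV[R]_d -> 'cV[R]_d))%type.

Definition H1 : set sobolev :=
  [set w | [/\ L2 w.1, L2vec w.2 & is_weak_gradient w.1 w.2]].

(* The closure of C_c^infty(Omega) in H^1(Omega). *)
Definition H10 : set sobolev :=
  [set w | H1 w /\ forall e : R, 0 < e ->
    exists phi, [/\ test_function phi, norm2 (w.1 - phi) < e &
                    norm2vec (w.2 - gradient phi) < e]].

Definition Hdiv : set (('rV[R]_d -> 'cV[R]_d) * ('rV[R]_d -> R)) :=
  [set y | [/\ L2vec y.1, L2 y.2 & is_weak_divergence y.1 y.2]].

Definition is_friedrichs_constant (CF : R) : Prop :=
  0 < CF /\ forall w, H10 w -> norm2 w.1 <= CF * norm2vec w.2.

Implicit Types A : 'rV[R]_d -> 'M[R]_d.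

Definition measurable_sym A : Prop :=
  (forall i j, measurable_fun cube (fun x => A x i j)) /\
  (forall x, cube x -> (A x)^T = A x).

Definition ess_bounded A : Prop :=
  exists M : R, {ae lebesgue_rV d, forall x, cube x -> forall i j, `|A x i j| <= M}.

Definition elliptic (lmin lmax : R) A : Prop :=
  forall x, cube x -> forall z : 'cV[R]_d,
    lmin * dot z z <= dot (A x *m z) z <= lmax * dot z z.

(* \int_Omega A grad v . grad w *)
Definition aform A (v w : sobolev) : R :=
  \int[lebesgue_rV d]_(x in cube) dot (A x *m v.2 x) (w.2 x).

Definition energy_norm A (w : sobolev) : R := Num.sqrt (aform A w w).

Definition majorant A0 Aeps f (rho CF lambda : R) (ut v : sobolev)
    (y : ('rV[R]_d -> 'cV[R]_d) * ('rV[R]_d -> R)) : R :=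
  let eta := (ut - v : sobolev) in
  let tau := fun x => y.1 x - rho *: (Aeps x *m v.2 x) in
  Num.sqrt (\int[lebesgue_rV d]_(x in cube)
    (dot (A0 x *m eta.2 x) (eta.2 x) + dot (invmx (A0 x) *m tau x) (tau x)
     - 2 * dot (eta.2 x) (tau x)))
  + CF / lambda * norm2 (fun x => y.2 x + rho * f x).

End sobolev.

Arguments sobolev : clear implicits.

(* Main.v *)
(* Write e = u_{k,h} - u_eps and let u be the exact next iterate.  Testing the
   equations of u and u_eps with w = u - u_eps gives
     |w|_0^2 = \int A_0 (grad e - rho A_0^-1 A_eps grad e) . grad w,
   and the spectral bounds make u_{k,h} |-> u a contraction of factor q towards
   u_eps.  For the discretisation error w = u_{k+1,h} - u, integrating y . grad w by
   parts turns |w|_0^2 into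
     \int (A_0 grad eta - tau) . grad w - \int (div y + rho f) w,
   which the Cauchy-Schwarz inequality (weighted by A_0) and the Friedrichs inequality
   bound by M |w|_0.  Both estimates follow from the triangle inequality. *)
Require Import Defs.
From HB Require Import structures.
From mathcomp Require Import all_boot all_order all_algebra.
From mathcomp Require Import all_classical all_reals all_analysis.
From mathcomp Require Import measurable_realfun ring lra.
Import Order.TTheory GRing.Theory Num.Theory numFieldNormedType.Exports.
Local Open Scope classical_set_scope.
Local Open Scope ring_scope.
Set Implicit Arguments.
Unset Strict Implicit.
Unset Printing Implicit Defensive.

(** * Borel measurability of continuous functions on R^n *)

Section continuous_measurable.
Context {R : realType} {n : nat}.
Implicit Types (f : 'rV[R]_n -> R) (x : 'rV[R]_n).

Let grid (k : nat) (z : 'rV[int]_n) : 'rV[R]_n :=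
  \row_i ((z ord0 i)%:~R / k.+1%:R).

Let round (k : nat) x : 'rV[int]_n := \row_i Num.floor (x ord0 i * k.+1%:R).

(** The fibre of [round k] over z is the half-open box of side 1/(k+1) with lower corner [grid k z],
    hence a finite intersection of preimages of intervals under the coordinates. *)
Let measurable_round k z : measurable [set x | round k x = z].
Proof.
rewrite (_ : [set _ | _] = \big[setI/setT]_(i <- index_enum 'I_n)
    (rV_coord i @^-1` `[(z ord0 i)%:~R / k.+1%:R, (z ord0 i + 1)%:~R / k.+1%:R[)).
  apply: bigsetI_measurable => i _; rewrite -[X in measurable X]setTI.
  exact: measurable_rV_coord.
have roundP x i : (round k x ord0 i = z ord0 i) <->
    ((z ord0 i)%:~R / k.+1%:R <= x ord0 i < (z ord0 i + 1)%:~R / k.+1%:R).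
  rewrite mxE ler_pdivrMr ?ltr_pdivlMr// -floor_eq; split => [->//|/eqP//].
rewrite -bigcap_seq; apply/seteqP; split => x /=.
  by move=> xz i _; rewrite /rV_coord/= in_itv/=; apply/roundP; rewrite xz.
move=> xz; apply/rowP => i; apply/roundP.
by have := xz i; rewrite /= mem_index_enum /rV_coord in_itv/=; exact.
Qed.

Let measurable_grid k f : measurable_fun setT (f \o grid k \o round k).
Proof.
move=> _ Y mY; rewrite setTI.
rewrite (_ : _ @^-1` _ = \bigcup_(z : 'rV[int]_n)
    (if `[< Y (f (grid k z)) >] then [set x | round k x = z] else set0)).
  apply: countable_bigcupT_measurable => // z.
  by case: ifP => _; [exact: measurable_round|exact: measurable0].
apply/seteqP; split => x /=.
  by move=> Yx; exists (round k x) => //; rewrite asboolT.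
by move=> [z _]; case: ifPn => // /asboolP Yz /= ->.
Qed.

(* x is the limit of the grid points obtained by rounding its coordinates down to
   multiples of 1/(k+1), and rounding takes countably many values. *)
Lemma continuous_measurable_rV f : continuous f -> measurable_fun setT f.
Proof.
move=> cf; apply: (measurable_fun_cvg (measurable_grid^~ f)) => x _.
apply: continuous_cvg; first exact: cf.
apply/cvg_ballP => e e0; near=> k => /=.
split => // i j; rewrite ord1 /ball/= !mxE.
have k0 : 0 < k.+1%:R :> R by [].
have ke : k.+1%:R^-1 < e by near: k; exact: (near_infty_natSinv_lt (PosNum e0)).
have /andP[lo hi] := floor_itv (x ord0 j * k.+1%:R).
have k1 : k.+1%:R * k.+1%:R^-1 = 1 :> R by rewrite divff ?gt_eqF.
have i0 : 0 < k.+1%:R^-1 :> R by rewrite invr_gt0.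
rewrite intrD in hi.
set t := (Num.floor _)%:~R in lo hi *.
rewrite (_ : _ - _ = (x ord0 j * k.+1%:R - t) / k.+1%:R); last first.
  by rewrite mulrBl -mulrA k1 mulr1.
rewrite ger0_norm; last by rewrite mulr_ge0 ?subr_ge0// ltW.
by rewrite (le_lt_trans _ ke)// ler_piMl ?(ltW i0)//; lra.
Unshelve. all: by end_near. Qed.

End continuous_measurable.

(** * The unit cube is measurable and has volume 1 *)

Section cube_measure.
Context {R : realType}.

Lemma measurable_cube n : measurable (cube : set 'rV[R]_n).
Proof.
rewrite (_ : cube = \big[setI/setT]_(i <- index_enum 'I_n)
    (rV_coord i @^-1` `]0, 1[)).
  apply: bigsetI_measurable => i _; rewrite -[X in measurable X]setTI.
  exact: measurable_rV_coord.
rewrite -bigcap_seq; apply/seteqP; split => x /= cx i.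
  by move=> _; rewrite /= /rV_coord in_itv/=; exact: cx.
by have := cx i; rewrite /= mem_index_enum /rV_coord in_itv/=; exact.
Qed.

(** Induction on the dimension: under [cons_rV] the cube pulls back to the product of the open unit
    interval and the cube one dimension lower. In dimension 0 the cube is the single point that
    carries the Dirac mass. *)
Lemma lebesgue_rV_cube n : lebesgue_rV n (cube : set 'rV[R]_n) = 1%E.
Proof.
elim: n => [|n IH].
  by rewrite /= diracE mem_set// => -[].
rewrite /= /lebesgue_rV_step /pushforward.
rewrite (_ : _ @^-1` _ = `]0, 1[%classic `*` cube).
  rewrite product_measure1E; [|exact: measurable_itv|exact: measurable_cube].
  rewrite IH mule1; transitivity (lebesgue_measure (`]0%R, 1%R[%classic : set R)) => //.
  by rewrite lebesgue_measure_itv/= lte01 oppr0 adde0.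
apply/seteqP; split => -[a v] /=.
  move=> cv; split; first by have := cv ord0; rewrite mxE unlift_none/= in_itv.
  by move=> i; have := cv (lift ord0 i); rewrite mxE liftK.
rewrite in_itv/= => -[a01 cv] i; rewrite mxE.
by case: unliftP => [j|] _.
Qed.
End cube_measure.

(** * Algebra of the dot product *)

Section dot_lemmas.
Context {R : realType} {d : nat}.
Implicit Types (a b c : 'cV[R]_d) (A : 'M[R]_d) (k : R).

Lemma dotE a b : dot a b = (a^T *m b) ord0 ord0.
Proof. by rewrite mxE; apply: eq_bigr => i _; rewrite mxE. Qed.

Lemma dotC a b : dot a b = dot b a.
Proof. by apply: eq_bigr => i _; rewrite mulrC. Qed.

Lemma dotDl a b c : dot (a + b) c = dot a c + dot b c.
Proof. by rewrite !dotE linearD mulmxDl mxE. Qed.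

Lemma dotNl a b : dot (- a) b = - dot a b.
Proof. by rewrite !dotE linearN mulNmx mxE. Qed.

Lemma dotZl k a b : dot (k *: a) b = k * dot a b.
Proof. by rewrite !dotE linearZ/= -scalemxAl mxE. Qed.

Lemma dotBl a b c : dot (a - b) c = dot a c - dot b c.
Proof. by rewrite dotDl dotNl. Qed.

Lemma dotDr a b c : dot c (a + b) = dot c a + dot c b.
Proof. by rewrite !(dotC c) dotDl. Qed.

Lemma dotNr a b : dot b (- a) = - dot b a.
Proof. by rewrite !(dotC b) dotNl. Qed.

Lemma dotZr k a b : dot b (k *: a) = k * dot b a.
Proof. by rewrite !(dotC b) dotZl. Qed.

Lemma dotBr a b c : dot c (a - b) = dot c a - dot c b.
Proof. by rewrite dotDr dotNr. Qed.

Lemma dot_ge0 a : 0 <= dot a a.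
Proof. by apply: sumr_ge0 => i _; rewrite -expr2 sqr_ge0. Qed.

Lemma dot_eq0 a : dot a a = 0 -> a = 0.
Proof.
move=> /eqP; rewrite psumr_eq0 => [/allP a0|i _]; last by rewrite -expr2 sqr_ge0.
apply/colP => i; rewrite mxE; apply/eqP.
by have := a0 i (mem_index_enum i); rewrite /= mulf_eq0 orbb.
Qed.

Lemma dot_mulmx_tr A a b : dot (A *m a) b = dot a (A^T *m b).
Proof. by rewrite !dotE trmx_mul mulmxA. Qed.

Lemma dot_mulmx_sym A a b : A^T = A -> dot (A *m a) b = dot (A *m b) a.
Proof. by move=> AT; rewrite dot_mulmx_tr AT dotC. Qed.

Lemma dot_delta a i : dot a (delta_mx i ord0) = a i ord0.
Proof.
rewrite /dot (bigD1 i)//= big1 => [|j ji]; rewrite mxE ?eqxx.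
  by rewrite mulr1 addr0.
by rewrite (negbTE ji) mulr0.
Qed.

Lemma dot_mulmx_delta A i j :
  dot (A *m delta_mx i ord0) (delta_mx j ord0) = A j i.
Proof. by rewrite dot_delta -colE mxE. Qed.
End dot_lemmas.

(** * Matrices with bounded quadratic forms: entries, invertibility, inverse *)

Section elliptic_matrix.
Context {R : realType} {d : nat}.
Implicit Types (a b c z : 'cV[R]_d) (A : 'M[R]_d) (k M : R).

(** Nonnegativity of the form at e_i + e_j and e_i - e_j bounds 2|A_ij| by A_ii + A_jj, and the
    diagonal entries lie between 0 and M. The factor 2 in the bound is not sharp; what matters is
    that form bounds yield entrywise bounds uniform in x. *)
Lemma psd_entry_le A M i j : A^T = A ->
  (forall z, 0 <= dot (A *m z) z <= M * dot z z) -> `|A i j| <= 2 * M.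
Proof.
move=> AT Az; pose e i : 'cV[R]_d := delta_mx i ord0.
have Asym : A i j = A j i by rewrite -[in LHS]AT mxE.
have eii l : dot (e l) (e l) = 1 by rewrite dot_delta mxE !eqxx.
have /andP[i0 iM] := Az (e i); have /andP[j0 jM] := Az (e j).
have /andP[p0 pM] := Az (e i + e j); have /andP[m0 mM] := Az (e i - e j).
rewrite !(mulmxDr, mulmxN, dotDl, dotDr, dotNl, dotNr) in p0 pM m0 mM.
rewrite !dot_mulmx_delta !eii -?Asym in i0 iM j0 jM p0 pM m0 mM.
rewrite (dotC (e j) (e i)) in pM mM.
by rewrite ler_norml; apply/andP; split; nra.
Qed.

(** A row of the kernel matrix of A^T transposes to a vector z with Az = 0; coercivity then gives
    k|z|^2 <= 0, so every such row vanishes. *)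
Lemma posdef_unitmx A k : 0 < k -> (forall z, k * dot z z <= dot (A *m z) z) ->
  A \in unitmx.
Proof.
move=> k0 Az; rewrite -unitmx_tr -row_free_unit -kermx_eq0.
apply/eqP/row_matrixP => i; rewrite row0.
have : row i (kermx A^T) *m A^T = 0.
  by rewrite -row_mul mulmx_ker row0.
move=> /(congr1 trmx); rewrite trmx_mul trmxK trmx0 => Ar.
have := Az (row i (kermx A^T))^T; rewrite Ar /dot.
rewrite [leRHS]big1 => [|j _]; last by rewrite mxE mul0r.
rewrite pmulr_rle0// => r0; apply: trmx_inj; rewrite trmx0; apply: dot_eq0.
by apply/le_anti/andP; split => //; exact: dot_ge0.
Qed.

(** With t = A^-1 z, coercivity reads k|t|^2 <= t.z, which gives the lower bound. Expanding |z -
    kt|^2 >= 0 and using k^2|t|^2 <= k t.z gives k t.z <= |z|^2. *)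
Lemma invmx_form_bounds A k : 0 < k -> (forall z, k * dot z z <= dot (A *m z) z) ->
  forall z, 0 <= dot (invmx A *m z) z <= k^-1 * dot z z.
Proof.
move=> k0 Az z; have Au := posdef_unitmx k0 Az.
set t := invmx A *m z; have At : A *m t = z by rewrite mulKVmx.
have := Az t; rewrite At dotC => tz.
have t0 : 0 <= dot t z by rewrite (le_trans _ tz)// mulr_ge0 ?dot_ge0// ltW.
rewrite t0/= ler_pdivlMl//.
have := dot_ge0 (z - k *: t); rewrite !(dotBl, dotBr, dotZl, dotZr) (dotC z t).
nra.
Qed.
End elliptic_matrix.

(** * Integrable and square-integrable functions and fields on the cube *)

Section square_integrable.
Context {R : realType} {d : nat}.
Implicit Types (f g h : 'rV[R]_d -> R) (F G : 'rV[R]_d -> 'cV[R]_d).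
Implicit Types (A : 'rV[R]_d -> 'M[R]_d).

Let mu := @lebesgue_rV R d.
Let D : set 'rV[R]_d := cube.
Let mD : measurable D := @measurable_cube R d.

Definition integrableR f := mu.-integrable D (EFin \o f).

Lemma integrableRD f g : integrableR f -> integrableR g ->
  integrableR (fun x => f x + g x).
Proof. by move=> f1 g1; apply: (eq_integrable mD _ _ _ (integrableD mD f1 g1)). Qed.

Lemma integrableRZ k f : integrableR f -> integrableR (fun x => k * f x).
Proof. by move=> f1; apply: (eq_integrable mD _ _ _ (integrableZl mD k f1)). Qed.

Lemma integrableRN f : integrableR f -> integrableR (fun x => - f x).
Proof.
move=> /(integrableRZ (-1)); congr (integrable _ _ _).
by apply/funext => x /=; rewrite mulN1r.
Qed.

Lemma integrableRB f g : integrableR f -> integrableR g ->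
  integrableR (fun x => f x - g x).
Proof. by move=> ? ?; apply: integrableRD => //; exact: integrableRN. Qed.

Lemma integrableR_le f g : measurable_fun cube f -> integrableR g ->
  (forall x, cube x -> `|f x| <= g x) -> integrableR f.
Proof.
move=> mf ig fg; apply: (le_integrable mD _ _ ig).
  exact/measurable_EFinP.
by move=> x Dx /=; rewrite lee_fin (le_trans (fg _ Dx))// ler_norm.
Qed.

Lemma integrableR_sum (I : eqType) (s : seq I) (h : I -> 'rV[R]_d -> R) :
  (forall i, integrableR (h i)) -> integrableR (fun x => \sum_(i <- s) h i x).
Proof.
move=> ih; elim: s => [|i s IH].
  rewrite (_ : (fun _ => _) = fun x => 0); last by apply/funext=> x; rewrite big_nil.
  exact: integrable0.
rewrite (_ : (fun _ => _) = fun x => h i x + \sum_(j <- s) h j x).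
  exact: integrableRD.
by apply/funext => x; rewrite big_cons.
Qed.

Lemma L2_measurable f : L2 f -> measurable_fun cube f.
Proof. by case. Qed.

Lemma L2_integrable_sqr f : L2 f -> integrableR (fun x => f x ^+ 2).
Proof. by case. Qed.

Lemma L2_mul_integrable f g : L2 f -> L2 g -> integrableR (fun x => f x * g x).
Proof.
move=> f2 g2; apply: (integrableR_le (g := fun x => f x ^+ 2 + g x ^+ 2)).
- by apply: measurable_funM; exact: L2_measurable.
- by apply: integrableRD; exact: L2_integrable_sqr.
- by move=> x _; rewrite ler_norml; apply/andP; split; nra.
Qed.

Lemma L2_le f g : measurable_fun cube f -> L2 g ->
  (forall x, cube x -> f x ^+ 2 <= g x ^+ 2) -> L2 f.
Proof.
move=> mf g2 fg; split => //; apply: (integrableR_le _ (L2_integrable_sqr g2)).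
  exact: measurable_funX.
by move=> x Dx; rewrite ger0_norm ?sqr_ge0//; exact: fg.
Qed.

Lemma L2D f g : L2 f -> L2 g -> L2 (fun x => f x + g x).
Proof.
move=> f2 g2; have mfg : measurable_fun cube (fun x => f x + g x).
  by apply: measurable_funD; exact: L2_measurable.
split => //; apply: (integrableR_le
    (g := fun x => 2 * (f x ^+ 2) + 2 * (g x ^+ 2))).
- exact: measurable_funX.
- by apply: integrableRD; apply: integrableRZ; exact: L2_integrable_sqr.
- move=> x _; rewrite ger0_norm ?sqr_ge0//; have := sqr_ge0 (f x - g x); nra.
Qed.

Lemma L2_bounded_mul f g k : measurable_fun cube f ->
  (forall x, cube x -> `|f x| <= k) -> L2 g -> L2 (fun x => f x * g x).
Proof.
move=> mf fk g2; apply: (@L2_le _ (fun x => k * g x)).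
- by apply: measurable_funM => //; exact: L2_measurable.
- split.
    by apply: measurable_funM => //; exact: L2_measurable.
  have := integrableRZ (k ^+ 2) (L2_integrable_sqr g2).
  by congr (integrable _ _ _); apply/funext => x /=; rewrite exprMn.
- move=> x Dx; rewrite !exprMn ler_wpM2r ?sqr_ge0//.
  by rewrite -[leLHS]real_normK ?num_real// lerXn2r ?nnegrE//
    ?(le_trans _ (fk x Dx))// fk.
Qed.

Lemma L2Z k f : L2 f -> L2 (fun x => k * f x).
Proof.
by apply: (@L2_bounded_mul (fun=> k) f `|k|) => //; exact: measurable_cst.
Qed.

Lemma L2N f : L2 f -> L2 (fun x => - f x).
Proof.
move=> /(L2Z (-1)); congr L2.
by apply/funext => x; rewrite mulN1r.
Qed.

Lemma L2B f g : L2 f -> L2 g -> L2 (fun x => f x - g x).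
Proof. by move=> f2 g2; apply: L2D => //; exact: L2N. Qed.

Lemma L2_sum (I : eqType) (s : seq I) (h : I -> 'rV[R]_d -> R) :
  (forall i, L2 (h i)) -> L2 (fun x => \sum_(i <- s) h i x).
Proof.
move=> ih; elim: s => [|i s IH].
  rewrite (_ : (fun _ => _) = fun x => 0); last by apply/funext=> x; rewrite big_nil.
  split; first exact: measurable_cst.
  by rewrite expr0n/=; exact: integrable0.
rewrite (_ : (fun _ => _) = fun x => h i x + \sum_(j <- s) h j x).
  exact: L2D.
by apply/funext => x; rewrite big_cons.
Qed.

(** The square of f is continuous, hence bounded on the compact closed cube, and the open cube
    inside it has finite volume. This places test functions and their partial derivatives in L^2. *)
Lemma continuous_L2 f : continuous f -> L2 f.
Proof.
move=> cf; have mf : measurable_fun D f.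
  by apply: measurable_funTS; exact: continuous_measurable_rV.
split; first exact: mf.
apply: (measurable_bounded_integrable (f := fun x => f x ^+ 2) mD).
- by change (mu D < +oo)%E; rewrite /mu lebesgue_rV_cube ltry.
- exact: measurable_funX.
- pose K := [set v : 'rV[R]_d | forall i, `[0, 1]%classic (v ord0 i)].
  have cK : compact K.
    apply: (@rV_compact R d (fun=> `[0, 1]%classic)) => i.
    exact: segment_compact.
  have : compact ((fun x => f x ^+ 2) @` K).
    apply: continuous_compact => //; apply: continuous_subspaceT => x.
    exact: (continuousM (cf x) (cf x)).
  move=> /compact_bounded[M [Mr KM]]; exists M; split => // r /KM Kr x Dx.
  apply: Kr; exists x => // i /=; rewrite in_itv/=.
  by have /andP[? ?] := Dx i; rewrite !ltW.
Qed.

Lemma L2vecD F G : L2vec F -> L2vec G -> L2vec (fun x => F x + G x).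
Proof.
move=> F2 G2 i; have := L2D (F2 i) (G2 i); congr L2.
by apply/funext => x; rewrite mxE.
Qed.

Lemma L2vecN F : L2vec F -> L2vec (fun x => - F x).
Proof.
move=> F2 i; have := L2N (F2 i); congr L2.
by apply/funext => x; rewrite mxE.
Qed.

Lemma L2vecB F G : L2vec F -> L2vec G -> L2vec (fun x => F x - G x).
Proof. by move=> F2 G2; apply: L2vecD => //; exact: L2vecN. Qed.

Lemma L2vecZ k F : L2vec F -> L2vec (fun x => k *: F x).
Proof.
move=> F2 i; have := L2Z k (F2 i); congr L2.
by apply/funext => x; rewrite mxE.
Qed.

Lemma L2vec_dot_integrable F G : L2vec F -> L2vec G ->
  integrableR (fun x => dot (F x) (G x)).
Proof.
by move=> F2 G2; apply: integrableR_sum => i; exact: L2_mul_integrable.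
Qed.

Lemma L2vec_mulmx A F M :
  (forall i j, measurable_fun cube (fun x => A x i j)) ->
  (forall x, cube x -> forall i j, `|A x i j| <= M) ->
  L2vec F -> L2vec (fun x => A x *m F x).
Proof.
move=> mA AM F2 i.
have : L2 (fun x => \sum_j A x i j * F x j ord0).
  apply: L2_sum => j; apply: (L2_bounded_mul (k := M)) => // x Dx.
  exact: AM.
by congr L2; apply/funext => x; rewrite mxE.
Qed.

End square_integrable.

(** * Cauchy-Schwarz and Minkowski inequalities from pointwise quadratics *)

Section integral_inequalities.
Context {R : realType} {d : nat}.
Implicit Types (a b c f g s : 'rV[R]_d -> R) (F G : 'rV[R]_d -> 'cV[R]_d).

Let mD : measurable (cube : set 'rV[R]_d) := @measurable_cube R d.

(** For A > 0 this is the discriminant inequality C^2 <= AB. For A <= 0 the right-hand side is 0,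
    since [Num.sqrt] vanishes there, and the quadratic can stay nonnegative only if C = 0. *)
Lemma discriminant_bound (A B C : R) :
  (forall t, 0 <= t ^+ 2 * A + 2 * t * C + B) ->
  `|C| <= Num.sqrt A * Num.sqrt B.
Proof.
move=> q0; have [A0|A0] := leP A 0.
  have [->|C0] := eqVneq C 0; first by rewrite normr0 mulr_ge0 ?sqrtr_ge0.
  (* This t makes the linear term equal to -(B + 1), so with A <= 0 the quadratic is at most -1: a
     contradiction. *)
  have := q0 (- (B + 1) / (2 * C)).
  rewrite (_ : 2 * _ * C = - (B + 1)); last by field.
  have : (- (B + 1) / (2 * C)) ^+ 2 * A <= 0 by rewrite mulr_ge0_le0 ?sqr_ge0.
  set u := _ * A; lra.
(* The minimiser of the quadratic, where its value is B - C^2/A. *)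
have := q0 (- C / A).
rewrite (_ : _ + B = B - C ^+ 2 / A); last by field; rewrite gt_eqF.
rewrite subr_ge0 ler_pdivrMr// mulrC => CAB.
by rewrite -sqrtrM ?(ltW A0)// -sqrtr_sqr; apply: ler_wsqrtr.
Qed.

(** The pointwise quadratic in t integrates to a nonnegative quadratic, whose discriminant is then
    bounded. Stating the hypothesis through quadratics covers at once the scalar and vector L^2
    products and the [A0]-weighted product with the integrand of the majorant. *)
Lemma Rint_cauchy_schwarz a b c :
  integrableR a -> integrableR b -> integrableR c ->
  (forall x, cube x -> forall t, 0 <= t ^+ 2 * a x + 2 * t * c x + b x) ->
  `|\int[lebesgue_rV d]_(x in cube) c x| <=
  Num.sqrt (\int[lebesgue_rV d]_(x in cube) a x) *
  Num.sqrt (\int[lebesgue_rV d]_(x in cube) b x).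
Proof.
move=> ia ib ic q0; apply: discriminant_bound => t.
rewrite -(RintegralZl _ mD ia) -(RintegralZl _ mD ic).
have ita : integrableR (fun x => t ^+ 2 * a x) := integrableRZ _ ia.
have itc : integrableR (fun x => 2 * t * c x) := integrableRZ _ ic.
rewrite -(RintegralD mD ita itc) -(RintegralD mD (integrableRD ita itc) ib).
by apply: Rintegral_ge0 => x Dx; exact: q0.
Qed.

(** Minkowski's inequality: a and b stand for the squared lengths of two fields, c for their product
    and s for the squared length of the sum. For a difference, c carries a minus sign. *)
Lemma sqrt_Rint_triangle s a b c :
  integrableR a -> integrableR b -> integrableR c ->
  (forall x, cube x -> forall t, 0 <= t ^+ 2 * a x + 2 * t * c x + b x) ->
  (forall x, cube x -> s x = a x + 2 * c x + b x) ->
  Num.sqrt (\int[lebesgue_rV d]_(x in cube) s x) <=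
  Num.sqrt (\int[lebesgue_rV d]_(x in cube) a x) +
  Num.sqrt (\int[lebesgue_rV d]_(x in cube) b x).
Proof.
move=> ia ib ic q0 sE.
have -> : \int[lebesgue_rV d]_(x in cube) s x =
    \int[lebesgue_rV d]_(x in cube) (a x + 2 * c x + b x).
  by apply: eq_Rintegral => x; rewrite inE => Dx; exact: sE.
have i2c : integrableR (fun x => 2 * c x) := integrableRZ _ ic.
rewrite (RintegralD mD (integrableRD ia i2c) ib) (RintegralD mD ia i2c).
rewrite (RintegralZl _ mD ic).
have := Rint_cauchy_schwarz ia ib ic q0.
set A := Rintegral _ _ a; set B := Rintegral _ _ b; set C := Rintegral _ _ c.
move=> /(le_trans (ler_norm _)) CAB.
(* Since [Num.sqrt] is 0 at negative arguments, this holds for either sign of x, so no sign of the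
   integrals A and B has to be established. *)
have sqr_sqrt_ge (x : R) : x <= Num.sqrt x ^+ 2.
  have [x0|x0] := leP 0 x; first by rewrite sqr_sqrtr.
  by rewrite (le_trans (ltW x0))// sqr_ge0.
rewrite -[leRHS]ger0_norm ?addr_ge0 ?sqrtr_ge0// -sqrtr_sqr ler_wsqrtr//.
have := sqr_sqrt_ge A; have := sqr_sqrt_ge B; nra.
Qed.

Lemma L2_cauchy_schwarz f g : L2 f -> L2 g ->
  `|\int[lebesgue_rV d]_(x in cube) (f x * g x)| <= norm2 f * norm2 g.
Proof.
move=> f2 g2; apply: Rint_cauchy_schwarz.
- exact: L2_integrable_sqr.
- exact: L2_integrable_sqr.
- exact: L2_mul_integrable.
- move=> x _ t; have := sqr_ge0 (t * f x + g x); nra.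
Qed.

Lemma dot_quadratic_ge0 (u v : 'cV[R]_d) t :
  0 <= t ^+ 2 * dot u u + 2 * t * dot u v + dot v v.
Proof.
have := dot_ge0 (t *: u + v); rewrite !(dotDl, dotDr, dotZl, dotZr) (dotC v u).
nra.
Qed.

Lemma L2vec_cauchy_schwarz F G : L2vec F -> L2vec G ->
  `|\int[lebesgue_rV d]_(x in cube) dot (F x) (G x)| <= norm2vec F * norm2vec G.
Proof.
move=> F2 G2; apply: Rint_cauchy_schwarz; try exact: L2vec_dot_integrable.
by move=> x _ t; exact: dot_quadratic_ge0.
Qed.

Lemma norm2B f g : L2 f -> L2 g -> norm2 (fun x => f x - g x) <= norm2 f + norm2 g.
Proof.
move=> f2 g2; apply: (sqrt_Rint_triangle (c := fun x => - (f x * g x))).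
- exact: L2_integrable_sqr.
- exact: L2_integrable_sqr.
- by apply: integrableRN; exact: L2_mul_integrable.
- move=> x _ t; have := sqr_ge0 (t * f x - g x); nra.
- by move=> x _ /=; ring.
Qed.

Lemma norm2vecB F G : L2vec F -> L2vec G ->
  norm2vec (fun x => F x - G x) <= norm2vec F + norm2vec G.
Proof.
move=> F2 G2; apply: (sqrt_Rint_triangle (c := fun x => - dot (F x) (G x))).
- exact: L2vec_dot_integrable.
- exact: L2vec_dot_integrable.
- by apply: integrableRN; exact: L2vec_dot_integrable.
- move=> x _ t; have := dot_quadratic_ge0 (F x) (- G x) t.
  by rewrite !(dotNl, dotNr) opprK.
- by move=> x _ /=; rewrite !(dotBl, dotBr) (dotC (G x) (F x)); ring.
Qed.

End integral_inequalities.

(** * Test functions, the space H^1_0 and integration by parts *)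

Section sobolev_lemmas.
Context {R : realType} {d : nat}.
Implicit Types (phi psi : 'rV[R]_d -> R) (v w : sobolev R d).

Let mD : measurable (cube : set 'rV[R]_d) := @measurable_cube R d.

Lemma test_function_L2 phi : test_function phi -> L2 phi.
Proof. by case=> /(_ 0%N)[cphi _] _ _; exact: continuous_L2. Qed.

Lemma test_function_derivable phi : test_function phi ->
  forall x i, derivable phi x (delta_mx ord0 i).
Proof. by case=> /(_ 1%N)[_ dphi] _ _ x i; have [] := dphi i. Qed.

Lemma test_function_partial_L2 phi i : test_function phi -> L2 (partial i phi).
Proof.
by case=> /(_ 1%N)[_ /(_ i)[_ [cphi _]]] _ _; exact: continuous_L2.
Qed.

Lemma test_function_gradient_L2 phi : test_function phi -> L2vec (gradient phi).
Proof.
move=> tphi i; have := test_function_partial_L2 i tphi; congr L2.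
by apply/funext => x; rewrite mxE.
Qed.

Lemma CdiffB k phi psi : Cdiff k phi -> Cdiff k psi -> Cdiff k (phi - psi).
Proof.
elim: k phi psi => [|k IH] phi psi [cphi dphi] [cpsi dpsi].
  by split => // x; exact: (continuousB (cphi x) (cpsi x)).
split=> [x|i]; first exact: (continuousB (cphi x) (cpsi x)).
have [ephi Cphi] := dphi i; have [epsi Cpsi] := dpsi i.
split=> [x|]; first exact: derivableB.
rewrite (_ : partial i _ = partial i phi - partial i psi); first exact: IH.
by apply/funext => x; rewrite /partial deriveB.
Qed.

Lemma test_functionB phi psi :
  test_function phi -> test_function psi -> test_function (phi - psi).
Proof.
move=> [Cphi kphi sphi] [Cpsi kpsi spsi].
have sub : closure [set x | (phi - psi) x != 0] `<=`
    closure [set x | phi x != 0] `|` closure [set x | psi x != 0].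
  rewrite -closureU; apply: closure_subset => x /=; apply: contraPP.
  move=> /not_orP[/negP/negPn/eqP phi0 /negP/negPn/eqP psi0].
  by apply/negP/negPn; rewrite -[(phi - psi) x]/(phi x - psi x) phi0 psi0 subr0.
split=> [k||].
- exact: CdiffB.
- apply: (subclosed_compact _ _ sub); first exact: closed_closure.
  exact: compactU.
- by apply: subset_trans sub _; rewrite subUset.
Qed.

Lemma gradientB phi psi : test_function phi -> test_function psi ->
  gradient (phi - psi) = gradient phi - gradient psi.
Proof.
move=> tphi tpsi; apply/funext => x; apply/colP => i.
rewrite -[(gradient phi - gradient psi) x]/(gradient phi x - gradient psi x).
by rewrite !mxE /partial deriveB//; exact: test_function_derivable.
Qed.

Lemma H10_L2 w : H10 w -> L2 w.1.
Proof. by case=> -[]. Qed.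

Lemma H10_L2vec w : H10 w -> L2vec w.2.
Proof. by case=> -[]. Qed.

Lemma H1B v w : H1 v -> H1 w -> H1 (v - w).
Proof.
move=> [v1 v2 vw] [w1 w2 ww]; split.
- exact: L2B.
- exact: L2vecB.
move=> phi tphi i.
have p2 := test_function_L2 tphi; have dp2 := test_function_partial_L2 i tphi.
have -> : \int[lebesgue_rV d]_(x in cube) ((v - w).1 x * partial i phi x) =
    \int[lebesgue_rV d]_(x in cube) (v.1 x * partial i phi x - w.1 x * partial i phi x).
  by apply: eq_Rintegral => x _; rewrite -mulrBl.
have -> : \int[lebesgue_rV d]_(x in cube) ((v - w).2 x i ord0 * phi x) =
    \int[lebesgue_rV d]_(x in cube) (v.2 x i ord0 * phi x - w.2 x i ord0 * phi x).
  apply: eq_Rintegral => x _; rewrite -mulrBl.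
  by rewrite -[(v - w).2 x]/(v.2 x - w.2 x) !mxE.
rewrite (RintegralB mD (L2_mul_integrable v1 dp2) (L2_mul_integrable w1 dp2)).
rewrite (RintegralB mD (L2_mul_integrable (v2 i) p2) (L2_mul_integrable (w2 i) p2)).
by rewrite vw// ww// opprB opprK addrC.
Qed.

(** Approximating v and w within e/2 by test functions, the difference of the approximants is a test
    function within e of v - w. *)
Lemma H10B v w : H10 v -> H10 w -> H10 (v - w).
Proof.
move=> [hv av] [hw aw]; split=> [|e e0]; first exact: H1B.
have e20 : 0 < e / 2 by rewrite divr_gt0.
have [phi [tphi p1 p2]] := av _ e20; have [psi [tpsi q1 q2]] := aw _ e20.
have [v1 v2 _] := hv; have [w1 w2 _] := hw.
have {}p1 : norm2 (fun x => v.1 x - phi x) < e / 2 := p1.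
have {}q1 : norm2 (fun x => w.1 x - psi x) < e / 2 := q1.
have {}p2 : norm2vec (fun x => v.2 x - gradient phi x) < e / 2 := p2.
have {}q2 : norm2vec (fun x => w.2 x - gradient psi x) < e / 2 := q2.
have tphi1 := test_function_L2 tphi; have tpsi1 := test_function_L2 tpsi.
have tphi2 := test_function_gradient_L2 tphi.
have tpsi2 := test_function_gradient_L2 tpsi.
exists (phi - psi); split; first exact: test_functionB.
- change (norm2 (fun x => v.1 x - w.1 x - (phi x - psi x)) < e).
  rewrite (_ : (fun _ => _) =
      (fun x => (v.1 x - phi x) - (w.1 x - psi x))); last first.
    by apply/funext => x; ring.
  rewrite (le_lt_trans (norm2B (L2B v1 tphi1) (L2B w1 tpsi1)))//.
  by rewrite [ltRHS]splitr; exact: ltrD p1 q1.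
- rewrite gradientB//.
  change (norm2vec (fun x => v.2 x - w.2 x - (gradient phi x - gradient psi x)) < e).
  rewrite (_ : (fun _ => _) =
      (fun x => (v.2 x - gradient phi x) - (w.2 x - gradient psi x))); last first.
    by apply/funext => x; apply/colP => i; rewrite !mxE; ring.
  rewrite (le_lt_trans (norm2vecB (L2vecB v2 tphi2) (L2vecB w2 tpsi2)))//.
  by rewrite [ltRHS]splitr; exact: ltrD p2 q2.
Qed.

(** By density: for test functions the identity is the definition of the weak divergence, and by
    Cauchy-Schwarz both integrals are continuous in w for the H^1 norm. The sum of the two sides is
    shown to be at most e in absolute value for every e > 0. *)
Lemma Hdiv_integration_by_parts (y : ('rV[R]_d -> 'cV[R]_d) * ('rV[R]_d -> R)) w :
  Hdiv y -> H10 w ->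
  \int[lebesgue_rV d]_(x in cube) dot (y.1 x) (w.2 x) =
  - \int[lebesgue_rV d]_(x in cube) (y.2 x * w.1 x).
Proof.
move=> [y1 y2 dy] [[w1 w2 _] aw]; apply/eqP; rewrite -addr_eq0 -normr_eq0 eq_le.
rewrite normr_ge0 andbT; apply/ler_addgt0Pr => e e0; rewrite add0r.
(* Approximating w within e/n makes the total error at most (|y| + |div y|) e/n <= e; the summand 1
   keeps n positive. *)
set n := norm2vec y.1 + norm2 y.2 + 1.
have n0 : 0 < n by rewrite ltr_wpDl// addr_ge0// sqrtr_ge0.
have [phi [tphi p1 p2]] := aw _ (divr_gt0 e0 n0).
have {}p1 : norm2 (fun x => w.1 x - phi x) < e / n := p1.
have {}p2 : norm2vec (fun x => w.2 x - gradient phi x) < e / n := p2.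
have q1 := test_function_L2 tphi; have q2 := test_function_gradient_L2 tphi.
have i1 := L2vec_dot_integrable y1 (L2vecB w2 q2).
have i2 := L2_mul_integrable y2 (L2B w1 q1).
have := L2vec_cauchy_schwarz y1 (L2vecB w2 q2).
have := L2_cauchy_schwarz y2 (L2B w1 q1).
have -> : \int[lebesgue_rV d]_(x in cube) (y.2 x * (w.1 x - phi x)) =
  \int[lebesgue_rV d]_(x in cube) (y.2 x * w.1 x) -
  \int[lebesgue_rV d]_(x in cube) (y.2 x * phi x).
  rewrite -(RintegralB mD (L2_mul_integrable y2 w1) (L2_mul_integrable y2 q1)).
  by apply: eq_Rintegral => x _; rewrite mulrBr.
have -> : \int[lebesgue_rV d]_(x in cube) dot (y.1 x) (w.2 x - gradient phi x) =
  \int[lebesgue_rV d]_(x in cube) dot (y.1 x) (w.2 x) -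
  \int[lebesgue_rV d]_(x in cube) dot (y.1 x) (gradient phi x).
  rewrite -(RintegralB mD (L2vec_dot_integrable y1 w2) (L2vec_dot_integrable y1 q2)).
  by apply: eq_Rintegral => x _; rewrite dotBr.
rewrite (dy _ tphi) opprK => b2 b1.
have n1 : 0 <= norm2vec y.1 by exact: sqrtr_ge0.
have n2 : 0 <= norm2 y.2 by exact: sqrtr_ge0.
have ne : n * (e / n) = e by rewrite mulrC divfK// gt_eqF.
have en0 : 0 < e / n by rewrite divr_gt0.
rewrite -[e]ne /n !mulrDl mul1r -[leLHS]/`|_ + _|.
set u := Rintegral _ _ (fun x => dot (y.1 x) (w.2 x)) in b1 *.
set u' := Rintegral _ _ (fun x => y.2 x * w.1 x) in b2 *.
set z := Rintegral _ _ (fun x => y.2 x * phi x) in b1 b2 *.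
(* As the integral of y . grad phi equals -z, the two brackets are the integrals of y . (grad w -
   grad phi) and of (div y)(w - phi), already bounded in b1 and b2. *)
rewrite (_ : u + u' = (u + z) + (u' - z)); last by ring.
rewrite (le_trans (ler_normD _ _))// ler_wpDr ?(ltW en0)// lerD//.
  by rewrite (le_trans b1)// ler_wpM2l// ltW.
by rewrite (le_trans b2)// ler_wpM2l// ltW.
Qed.

End sobolev_lemmas.

(** * Measurability of determinants and of matrix inverses *)

Section measurable_inverse.
Context {d : measure_display} {T : measurableType d} {R : realType}.
Implicit Types D : set T.

Lemma measurable_funV D (f : T -> R) : measurable_fun D f ->
  measurable_fun D (fun x => (f x)^-1).
Proof.
(* powR is the inverse only at nonnegative bases, whence the square *)
move=> mf; rewrite (_ : (fun _ => _) = (fun x => f x * (f x ^+ 2) `^ (-1))).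
  apply: measurable_funM => //.
  apply: (measurableT_comp (measurable_powR (-1))).
  exact: measurable_funX.
apply/funext => x; rewrite powR_inv1 ?sqr_ge0//.
have [->|fx0] := eqVneq (f x) 0; first by rewrite invr0 mul0r.
by field.
Qed.

Lemma measurable_det n D (A : T -> 'M[R]_n) :
  (forall i j, measurable_fun D (fun x => A x i j)) ->
  measurable_fun D (fun x => \det (A x)).
Proof.
move=> mA; apply: measurable_sum => s.
by apply: measurable_funM => //; apply: measurable_prod => i _.
Qed.

(** By Cramer's rule, an entry of the inverse is a cofactor divided by the determinant, and a
    cofactor is a signed determinant of a submatrix. *)
Lemma measurable_invmx n D (A : T -> 'M[R]_n) :
  (forall x, D x -> A x \in unitmx) ->
  (forall i j, measurable_fun D (fun x => A x i j)) ->
  forall i j, measurable_fun D (fun x => invmx (A x) i j).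
Proof.
move=> uA mA i j.
apply: (@eq_measurable_fun _ _ _ _ _
    (fun x => (\det (A x))^-1 * cofactor (A x) j i)).
  by move=> x; rewrite inE => /uA Au; rewrite /invmx Au !mxE.
apply: measurable_funM; first exact/measurable_funV/measurable_det.
apply: measurable_funM => //; apply: measurable_det => k l.
rewrite (_ : (fun _ => _) = (fun x => A x (lift j k) (lift i l))) //.
by apply/funext => x; rewrite !mxE.
Qed.

End measurable_inverse.

(** * Energy forms and norms of elliptic matrix functions *)

Section energy.
Context {R : realType} {d : nat}.
Implicit Types (A B : 'rV[R]_d -> 'M[R]_d) (k M : R).
Implicit Types (F G : 'rV[R]_d -> 'cV[R]_d) (v w : sobolev R d).

Let mD : measurable (cube : set 'rV[R]_d) := @measurable_cube R d.

(** The weaker property [elliptic 0 M] is the common hypothesis of the lemmas on forms, so that they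
    apply alike to [A0], to [Aeps] and to the inverse of [A0]. *)
Lemma elliptic_ge0 A k M : 0 <= k -> elliptic k M A -> elliptic 0 M A.
Proof.
move=> k0 eA x Dx z; have /andP[lo ->] := eA x Dx z.
by rewrite mul0r (le_trans _ lo)// mulr_ge0// dot_ge0.
Qed.

Lemma elliptic_unitmx A k M : 0 < k -> elliptic k M A ->
  forall x, cube x -> A x \in unitmx.
Proof.
move=> k0 eA x Dx; apply: (posdef_unitmx k0) => z.
by have /andP[] := eA x Dx z.
Qed.

Lemma invmx_measurable_sym A k M : 0 < k -> measurable_sym A -> elliptic k M A ->
  measurable_sym (fun x => invmx (A x)).
Proof.
move=> k0 [mA sA] eA; split=> [i j|x Dx].
  by apply: measurable_invmx => // x; exact: elliptic_unitmx eA x.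
by rewrite trmx_inv sA.
Qed.

Lemma invmx_elliptic A k M : 0 < k -> elliptic k M A ->
  elliptic 0 k^-1 (fun x => invmx (A x)).
Proof.
move=> k0 eA x Dx z; rewrite mul0r.
by apply: invmx_form_bounds => // t; have /andP[] := eA x Dx t.
Qed.

(** Symmetry and the form bound give the entrywise bound 2M on the cube, by [psd_entry_le], and
    bounded measurable coefficients preserve L^2. *)
Lemma elliptic_L2vec A M F : measurable_sym A -> elliptic 0 M A -> L2vec F ->
  L2vec (fun x => A x *m F x).
Proof.
move=> [mA sA] eA; apply: (L2vec_mulmx (M := 2 * M)) => // x Dx i j.
apply: psd_entry_le; first exact: sA.
by move=> z; have := eA x Dx z; rewrite mul0r.
Qed.

Lemma psd_quadratic_ge0 A M : measurable_sym A -> elliptic 0 M A ->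
  forall x, cube x -> forall (a b : 'cV[R]_d) t,
  0 <= t ^+ 2 * dot (A x *m a) a + 2 * t * dot (A x *m a) b + dot (A x *m b) b.
Proof.
move=> [_ sA] eA x Dx a b t; have := eA x Dx (t *: a + b).
rewrite mul0r => /andP[+ _].
rewrite mulmxDr -scalemxAr !(dotDl, dotDr, dotZl, dotZr).
by rewrite (dot_mulmx_sym b a (sA x Dx)); nra.
Qed.

Lemma aform_integrable A M v w : measurable_sym A -> elliptic 0 M A ->
  L2vec v.2 -> L2vec w.2 -> integrableR (fun x => dot (A x *m v.2 x) (w.2 x)).
Proof.
by move=> sA eA v2 w2; apply: L2vec_dot_integrable => //; exact: elliptic_L2vec eA v2.
Qed.

Lemma aformBl A M v v' w : measurable_sym A -> elliptic 0 M A ->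
  L2vec v.2 -> L2vec v'.2 -> L2vec w.2 ->
  aform A (v - v') w = aform A v w - aform A v' w.
Proof.
move=> sA eA v2 v'2 w2.
rewrite -(RintegralB mD (aform_integrable sA eA v2 w2) (aform_integrable sA eA v'2 w2)).
apply: eq_Rintegral => x _; rewrite -[(v - v').2 x]/(v.2 x - v'.2 x).
by rewrite mulmxBr dotBl.
Qed.

Lemma aform_ge0 A M v : elliptic 0 M A -> 0 <= aform A v v.
Proof.
move=> eA; apply: Rintegral_ge0 => x Dx.
by have := eA x Dx (v.2 x); rewrite mul0r => /andP[].
Qed.

Lemma energy_normB A M v w : measurable_sym A -> elliptic 0 M A ->
  L2vec v.2 -> L2vec w.2 ->
  energy_norm A (v - w) <= energy_norm A v + energy_norm A w.
Proof.
move=> sA eA v2 w2.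
apply: (sqrt_Rint_triangle (c := fun x => - dot (A x *m v.2 x) (w.2 x))).
- exact: (aform_integrable sA eA v2 v2).
- exact: (aform_integrable sA eA w2 w2).
- by apply: integrableRN; exact: (aform_integrable sA eA v2 w2).
- move=> x Dx t; have := psd_quadratic_ge0 sA eA Dx (- v.2 x) (w.2 x) t.
  by rewrite mulmxN !(dotNl, dotNr); nra.
- move=> x Dx; rewrite -[(v - w).2 x]/(v.2 x - w.2 x).
  rewrite mulmxBr !(dotBl, dotBr) (dot_mulmx_sym (w.2 x) (v.2 x) (sA.2 x Dx)).
  ring.
Qed.

Lemma energy_norm_subC A v w : energy_norm A (v - w) = energy_norm A (w - v).
Proof.
congr Num.sqrt; apply: eq_Rintegral => x _.
rewrite -[(v - w).2 x]/(v.2 x - w.2 x) -[(w - v).2 x]/(w.2 x - v.2 x).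
by rewrite -[w.2 x - _]opprB mulmxN dotNl dotNr opprK.
Qed.

Lemma energy_norm_triangle A M v w z : measurable_sym A -> elliptic 0 M A ->
  L2vec v.2 -> L2vec w.2 -> L2vec z.2 ->
  energy_norm A (v - w) <= energy_norm A (v - z) + energy_norm A (z - w).
Proof.
move=> sA eA v2 w2 z2; rewrite (energy_norm_subC A z w).
rewrite (_ : v - w = (v - z) - (w - z)).
  by apply: energy_normB sA eA _ _; exact: L2vecB.
by rewrite opprB addrA subrK.
Qed.

(** Ellipticity gives k|grad v|^2 <= |v|_A^2, that is, the factor sqrt(k). For k <= 1 one has k^2 <=
    k, so the factor k is admissible too; it is the one matching C_F / lambda in [majorant]. *)
Lemma norm2vec_le_energy A k M v : 0 < k <= 1 -> measurable_sym A ->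
  elliptic k M A -> L2vec v.2 -> k * norm2vec v.2 <= energy_norm A v.
Proof.
move=> /andP[k0 k1] sA eA v2.
have eA0 := elliptic_ge0 (ltW k0) eA.
have ivv := L2vec_dot_integrable v2 v2.
have : k * \int[lebesgue_rV d]_(x in cube) dot (v.2 x) (v.2 x) <= aform A v v.
  rewrite -(RintegralZl _ mD ivv); apply: le_Rintegral => //.
  - exact: integrableRZ.
  - exact: (aform_integrable sA eA0 v2 v2).
  - by move=> x Dx; have /andP[] := eA x Dx (v.2 x).
have : 0 <= \int[lebesgue_rV d]_(x in cube) dot (v.2 x) (v.2 x).
  by apply: Rintegral_ge0 => x _; exact: dot_ge0.
rewrite /norm2vec; set S := Rintegral _ _ _ => S0 kS.
rewrite -[leLHS]ger0_norm ?mulr_ge0 ?sqrtr_ge0 ?(ltW k0)// -sqrtr_sqr.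
apply: ler_wsqrtr; rewrite exprMn sqr_sqrtr// (le_trans _ kS)//.
by rewrite ler_wpM2r// expr2 ler_piMr// ltW.
Qed.

End energy.

(** * Pointwise inequalities behind the contraction and the majorant *)

Section pointwise_estimates.
Context {R : realType} {d : nat}.
Implicit Types (A E : 'M[R]_d) (a b e z w : 'cV[R]_d).

(** Young's inequality for the form of A, applied to w and z - rho p with p = A^-1 E z: the form is
    nonnegative at w - (z - rho p). As Ap.p = E A^-1 E z.z, the form at z - rho p is Az.z - 2 rho
    Ez.z + rho^2 E A^-1 E z.z, which the two spectral bounds estimate. *)
Lemma contraction_pointwise A E (lambda c rho : R) z w :
  A^T = A -> A \in unitmx -> (forall a, 0 <= dot (A *m a) a) -> 0 <= rho ->
  lambda * dot (A *m z) z <= dot (E *m z) z ->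
  dot (E *m invmx A *m E *m z) z <= c * dot (A *m z) z -> E^T = E ->
  2 * (dot (A *m z) w - rho * dot (E *m z) w) <=
  dot (A *m w) w + (1 - 2 * rho * lambda + rho ^+ 2 * c) * dot (A *m z) z.
Proof.
move=> AT Au A0 rho0 lo up ET; set p := invmx A *m (E *m z).
have Ap : A *m p = E *m z by rewrite mulKVmx.
have Ep : dot (E *m z) p = dot (E *m invmx A *m E *m z) z.
  by rewrite (dot_mulmx_sym z p ET) /p !mulmxA.
clearbody p; have := A0 (w - (z - rho *: p)).
rewrite !mulmxBr -scalemxAr Ap !(dotBl, dotBr, dotZl, dotZr).
rewrite (dot_mulmx_sym w p AT) Ap (dot_mulmx_sym w z AT).
rewrite (dot_mulmx_sym z p AT) Ap.
have r2 : 0 <= rho ^+ 2 by rewrite sqr_ge0.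
rewrite Ep; set X := dot (E *m invmx A *m E *m z) z in up *.
have := ler_wpM2l r2 up; have := ler_wpM2l rho0 lo; nra.
Qed.

(** The quadratic is the form of A at tw + (e - A^-1 z). Its constant term, the integrand of the
    majorant, is thus the form at e - A^-1 z, written out without that vector. *)
Lemma majorant_pointwise A e w z t :
  A^T = A -> A \in unitmx -> (forall a, 0 <= dot (A *m a) a) ->
  0 <= t ^+ 2 * dot (A *m w) w + 2 * t * dot (A *m e - z) w +
    (dot (A *m e) e + dot (invmx A *m z) z - 2 * dot e z).
Proof.
move=> AT Au A0; set p := invmx A *m z.
have Ap : A *m p = z by rewrite mulKVmx.
clearbody p; have := A0 (t *: w + (e - p)).
rewrite mulmxDr mulmxBr -scalemxAr Ap !(dotDl, dotDr, dotNl, dotNr, dotZl, dotZr).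
rewrite (dot_mulmx_sym w e AT) (dot_mulmx_sym w p AT) Ap.
rewrite (dot_mulmx_sym e p AT) Ap (dotC z e) (dotC z p); nra.
Qed.

End pointwise_estimates.

(** * Contraction of the iteration and the bound for the discretisation error *)

Section a_posteriori.
Context {R : realType} {d : nat}.
Implicit Types (A Aeps : 'rV[R]_d -> 'M[R]_d) (f : 'rV[R]_d -> R).
Implicit Types (u v w ueps : sobolev R d).

Let mD : measurable (cube : set 'rV[R]_d) := @measurable_cube R d.

Lemma source_form f Aeps M v w : measurable_sym Aeps -> elliptic 0 M Aeps ->
  L2 f -> L2vec v.2 -> H10 w ->
  \int[lebesgue_rV d]_(x in cube) (dot (Aeps x *m v.2 x) (w.2 x) - f x * w.1 x) =
  aform Aeps v w - \int[lebesgue_rV d]_(x in cube) (f x * w.1 x).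
Proof.
move=> sA eA f2 v2 hw.
rewrite (RintegralB mD (aform_integrable sA eA v2 (H10_L2vec hw))
  (L2_mul_integrable f2 (H10_L2 hw))).
by [].
Qed.

Lemma iteration_contraction A0 Aeps f l0 M0 M lambda c rho v u ueps :
  0 < l0 -> measurable_sym A0 -> elliptic l0 M0 A0 ->
  measurable_sym Aeps -> elliptic 0 M Aeps -> L2 f ->
  (forall x, cube x -> forall z : 'cV[R]_d,
     lambda * dot (A0 x *m z) z <= dot (Aeps x *m z) z) ->
  (forall x, cube x -> forall z : 'cV[R]_d,
     dot (Aeps x *m invmx (A0 x) *m Aeps x *m z) z <= c * dot (A0 x *m z) z) ->
  0 <= rho -> H10 v -> H10 u -> H10 ueps ->
  (forall w, H10 w ->
     aform Aeps ueps w = \int[lebesgue_rV d]_(x in cube) (f x * w.1 x)) ->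
  (forall w, H10 w ->
     aform A0 u w = aform A0 v w
       - rho * \int[lebesgue_rV d]_(x in cube)
                 (dot (Aeps x *m v.2 x) (w.2 x) - f x * w.1 x)) ->
  energy_norm A0 (u - ueps) <=
  Num.sqrt (1 - 2 * rho * lambda + rho ^+ 2 * c) * energy_norm A0 (v - ueps).
Proof.
move=> l00 s0 e0 s1 e1 f2 lo up rho0 hv hu he eps_sol u_sol.
have e0' := elliptic_ge0 (ltW l00) e0.
have [v2 u2 ue2] := And3 (H10_L2vec hv) (H10_L2vec hu) (H10_L2vec he).
pose w := u - ueps; pose z := v - ueps.
have hw : H10 w by exact: H10B.
have w2 := H10_L2vec hw; have z2 : L2vec z.2 by exact: H10_L2vec (H10B hv he).
set k := 1 - 2 * rho * lambda + rho ^+ 2 * c.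
(* The load f disappears because [ueps] solves the limit equation tested with the same w. *)
have step : aform A0 w w = aform A0 z w - rho * aform Aeps z w.
  rewrite (aformBl s0 e0' u2 ue2 w2) (aformBl s0 e0' v2 ue2 w2).
  rewrite (aformBl s1 e1 v2 ue2 w2) u_sol// (source_form s1 e1 f2 v2 hw).
  by rewrite -eps_sol//; ring.
have izw := aform_integrable s0 e0' z2 w2; have iww := aform_integrable s0 e0' w2 w2.
have izz := aform_integrable s0 e0' z2 z2; have i1zw := aform_integrable s1 e1 z2 w2.
(* Combined with [step], this reads 2|w|^2 <= |w|^2 + k|z|^2 in the energy norm, hence |w|^2 <=
   k|z|^2. *)
have young : 2 * (aform A0 z w - rho * aform Aeps z w) <=
    aform A0 w w + k * aform A0 z z.
  have irzw := integrableRZ rho i1zw; have ikzz := integrableRZ k izz.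
  rewrite /aform -(RintegralZl _ mD i1zw) -(RintegralB mD izw irzw).
  rewrite -(RintegralZl _ mD (integrableRB izw irzw)) -(RintegralZl _ mD izz).
  rewrite -(RintegralD mD iww ikzz); apply: le_Rintegral => //.
  - exact: integrableRZ (integrableRB izw irzw).
  - exact: integrableRD.
  - move=> x Dx; apply: contraction_pointwise => //.
    + exact: s0.2.
    + exact: (elliptic_unitmx l00 e0).
    + by move=> a; have := e0' x Dx a; rewrite mul0r => /andP[].
    + exact: lo.
    + exact: up.
    + exact: s1.2.
(* The factors are swapped so that the product rule for square roots asks for nonnegativity of the
   energy of z rather than of k. *)
rewrite /energy_norm -/w -/z mulrC -sqrtrM; last exact: (aform_ge0 _ e0').
apply: ler_wsqrtr; rewrite -step in young; move: young.
by move: (aform A0 w w) (aform A0 z z) => X Y; lra.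
Qed.

Lemma majorant_bound A0 Aeps f l0 M0 M CF rho v ut u
    (y : ('rV[R]_d -> 'cV[R]_d) * ('rV[R]_d -> R)) :
  0 < l0 <= 1 -> measurable_sym A0 -> elliptic l0 M0 A0 ->
  measurable_sym Aeps -> elliptic 0 M Aeps -> L2 f ->
  is_friedrichs_constant (d := d) CF -> H10 v -> H10 ut -> H10 u -> Hdiv y ->
  (forall w, H10 w ->
     aform A0 u w = aform A0 v w
       - rho * \int[lebesgue_rV d]_(x in cube)
                 (dot (Aeps x *m v.2 x) (w.2 x) - f x * w.1 x)) ->
  energy_norm A0 (ut - u) <= majorant A0 Aeps f rho CF l0 ut v y.
Proof.
move=> l01 s0 e0 s1 e1 f2 [CF0 friedrichs] hv hut hu hy u_sol.
have /andP[l00 _] := l01; have e0' := elliptic_ge0 (ltW l00) e0.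
have [v2 u2 ut2] := And3 (H10_L2vec hv) (H10_L2vec hu) (H10_L2vec hut).
have [y1 y2 _] := hy.
pose w := ut - u; pose eta := ut - v.
have hw : H10 w by exact: H10B.
have w1 := H10_L2 hw; have w2 := H10_L2vec hw.
have eta2 : L2vec eta.2 by exact: H10_L2vec (H10B hut hv).
pose tau := fun x => y.1 x - rho *: (Aeps x *m v.2 x).
pose r := fun x => y.2 x + rho * f x.
have Av2 : L2vec (fun x => Aeps x *m v.2 x) by exact: elliptic_L2vec e1 v2.
have Aeta2 : L2vec (fun x => A0 x *m eta.2 x) by exact: elliptic_L2vec e0' eta2.
have tau2 : L2vec tau by apply: L2vecB => //; exact: L2vecZ.
have r2 : L2 r by apply: L2D => //; exact: L2Z.
have itau := L2vec_dot_integrable tau2 w2.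
have iyw := L2vec_dot_integrable y1 w2.
have iAv := aform_integrable s1 e1 v2 w2.
have iew := aform_integrable s0 e0' eta2 w2.
have iww := aform_integrable s0 e0' w2 w2.
have iee := aform_integrable s0 e0' eta2 eta2.
have iet := L2vec_dot_integrable eta2 tau2.
have itt : integrableR (fun x => dot (invmx (A0 x) *m tau x) (tau x)).
  apply: L2vec_dot_integrable => //; apply: elliptic_L2vec tau2.
    exact: invmx_measurable_sym e0.
  exact: invmx_elliptic e0.
(* The terms containing y cancel by integration by parts, so y may be inserted freely; what remains
   is the equation of u tested with w. *)
have residual : aform A0 w w =
    \int[lebesgue_rV d]_(x in cube) dot (A0 x *m eta.2 x - tau x) (w.2 x) -
    \int[lebesgue_rV d]_(x in cube) (r x * w.1 x).
  have -> : \int[lebesgue_rV d]_(x in cube) dot (A0 x *m eta.2 x - tau x) (w.2 x) =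
      aform A0 eta w - \int[lebesgue_rV d]_(x in cube) dot (tau x) (w.2 x).
    by rewrite -(RintegralB mD iew itau); apply: eq_Rintegral => x _; rewrite dotBl.
  have -> : \int[lebesgue_rV d]_(x in cube) dot (tau x) (w.2 x) =
      \int[lebesgue_rV d]_(x in cube) dot (y.1 x) (w.2 x) - rho * aform Aeps v w.
    rewrite -(RintegralZl _ mD iAv) -(RintegralB mD iyw (integrableRZ rho iAv)).
    by apply: eq_Rintegral => x _; rewrite dotBl dotZl.
  have -> : \int[lebesgue_rV d]_(x in cube) (r x * w.1 x) =
      \int[lebesgue_rV d]_(x in cube) (y.2 x * w.1 x) +
      rho * \int[lebesgue_rV d]_(x in cube) (f x * w.1 x).
    have ifw := L2_mul_integrable f2 w1.
    rewrite -(RintegralZl _ mD ifw).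
    rewrite -(RintegralD mD (L2_mul_integrable y2 w1) (integrableRZ rho ifw)).
    by apply: eq_Rintegral => x _; rewrite mulrDl mulrA.
  rewrite (Hdiv_integration_by_parts hy hw) (aformBl s0 e0' ut2 u2 w2).
  rewrite (aformBl s0 e0' ut2 v2 w2) u_sol// (source_form s1 e1 f2 v2 hw).
  ring.
(* Weighted Cauchy-Schwarz: a is the energy density of w and b the integrand of the majorant,
   coupled by [majorant_pointwise]. *)
have cs1 : `|\int[lebesgue_rV d]_(x in cube) dot (A0 x *m eta.2 x - tau x) (w.2 x)|
    <= energy_norm A0 w * Num.sqrt (\int[lebesgue_rV d]_(x in cube)
      (dot (A0 x *m eta.2 x) (eta.2 x) + dot (invmx (A0 x) *m tau x) (tau x)
       - 2 * dot (eta.2 x) (tau x))).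
  apply: Rint_cauchy_schwarz => //.
  - apply: integrableRB; last exact: integrableRZ.
    exact: integrableRD.
  - by apply: L2vec_dot_integrable => //; exact: L2vecB.
  - move=> x Dx t; apply: majorant_pointwise.
    + exact: s0.2.
    + exact: (elliptic_unitmx l00 e0).
    + by move=> a; have := e0' x Dx a; rewrite mul0r => /andP[].
have cs2 := L2_cauchy_schwarz r2 w1.
have fr := friedrichs _ hw; have ne := norm2vec_le_energy l01 s0 e0 w2.
have S0 := aform_ge0 w e0'.
have SE : aform A0 w w = energy_norm A0 w ^+ 2 by rewrite sqr_sqrtr.
rewrite /majorant -/eta -/tau -/r -/w.
move: cs1 cs2; rewrite !ler_norml => /andP[_ cs1] /andP[cs2 _].
rewrite SE in residual.
have s_ge0 : 0 <= energy_norm A0 w by exact: sqrtr_ge0.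
have N0 : 0 <= norm2 r by exact: sqrtr_ge0.
set m := Num.sqrt _ in cs1 *; have m0 : 0 <= m by exact: sqrtr_ge0.
set s := energy_norm A0 w in residual cs1 ne s_ge0 *.
set N := norm2 r in cs2 N0 *.
(* If s = 0 the claim is nonnegativity of the majorant; otherwise the bound for s^2 is divided by
   s. *)
have [->|s_neq0] := eqVneq s 0.
  by rewrite addr_ge0// mulr_ge0// divr_ge0// ltW.
have s_gt0 : 0 < s by rewrite lt_neqAle eq_sym s_neq0.
(* Friedrichs, then ellipticity: |w| <= C_F |grad w| <= C_F s / l0. *)
have bound : N * norm2 w.1 <= CF / l0 * N * s.
  have -> : CF / l0 * N * s = N * (CF * (s / l0)) by ring.
  rewrite ler_wpM2l// (le_trans fr)// ler_wpM2l ?(ltW CF0)//.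
  by rewrite ler_pdivlMr// mulrC.
rewrite -(ler_pM2r s_gt0) -expr2 residual mulrDl; lra.
Qed.

End a_posteriori.

(** The letters stand for energy distances: e from [ukh] to [ueps], h from [ukh1] to [ukh], a from
    [ukh1] to [ueps], b from [ukh1] to u, c from u to [ueps], g from u to [ukh]. The chain e <= h +
    b + c <= h + M + qe gives the upper estimate, and h <= b + c + e <= M + (1 + q)e the lower
    one. *)
Lemma error_two_sided (R : realFieldType) (q e h a b g c M : R) :
  0 <= q -> q < 1 -> e <= h + a -> a <= b + c -> h <= b + g -> g <= c + e ->
  c <= q * e -> b <= M ->
  e <= (1 - q)^-1 * (h + M) /\ (1 + q)^-1 * (h - M) <= e.
Proof.
move=> q0 q1 e1 a1 h1 g1 c1 b1; split.
- by rewrite ler_pdivlMl ?subr_gt0// mulrBl mul1r; lra.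
- by rewrite ler_pdivrMl ?ltr_wpDr// mulrDl mul1r; lra.
Qed.

(** * The two-sided a posteriori estimate *)

Unset Implicit Arguments.

Theorem mainTheorem4 (R : realType) (d : nat) (hd : (1 <= d <= 3)%N)
  (f : 'rV[R]_d -> R) (hf : L2 f)
  (Aeps A0 : 'rV[R]_d -> 'M[R]_d)
  (hAeps : measurable_sym Aeps) (hAeps_bounded : ess_bounded Aeps)
  (hA0 : measurable_sym A0)
  (lambdaeps_min lambdaeps_max lambda0_min lambda0_max : R)
  (hlambdaeps_min : 0 < lambdaeps_min) (hlambdaeps_max : 0 < lambdaeps_max)
  (hlambda0_min : 0 < lambda0_min) (hlambda0_max : 0 < lambda0_max)
  (hlambda0_min_le1 : lambda0_min <= 1)
  (hell_eps : elliptic lambdaeps_min lambdaeps_max Aeps)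
  (hell_0 : elliptic lambda0_min lambda0_max A0)
  (lambda1 cmax : R) (hlambda1 : 0 < lambda1) (hcmax : 0 < cmax)
  (hlower : forall x, cube x -> forall z : 'cV[R]_d,
     lambda1 * dot (A0 x *m z) z <= dot (Aeps x *m z) z)
  (hupper : forall x, cube x -> forall z : 'cV[R]_d,
     dot (Aeps x *m invmx (A0 x) *m Aeps x *m z) z <= cmax * dot (A0 x *m z) z)
  (rho : R) (hrho : 0 < rho < 2 * lambda1 / cmax)
  (q : R) (hq : q = Num.sqrt (1 - 2 * rho * lambda1 + rho ^+ 2 * cmax))
  (CF : R) (hCF : is_friedrichs_constant (d := d) CF)
  (ueps : sobolev R d) (hueps : H10 ueps)
  (hueps_sol : forall w, H10 w ->
     aform Aeps ueps w = \int[lebesgue_rV d]_(x in cube) (f x * w.1 x))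
  (ukh ukh1 u : sobolev R d) (hukh : H10 ukh) (hukh1 : H10 ukh1) (hu : H10 u)
  (hu_sol : forall w, H10 w ->
     aform A0 u w = aform A0 ukh w
       - rho * \int[lebesgue_rV d]_(x in cube)
                 (dot (Aeps x *m ukh.2 x) (w.2 x) - f x * w.1 x))
  (y : ('rV[R]_d -> 'cV[R]_d) * ('rV[R]_d -> R)) (hy : Hdiv y) :
  energy_norm A0 (ukh - ueps) <=
    (1 - q)^-1 * (energy_norm A0 (ukh1 - ukh)
                  + majorant A0 Aeps f rho CF lambda0_min ukh1 ukh y) /\
  (1 + q)^-1 * (energy_norm A0 (ukh1 - ukh)
                - majorant A0 Aeps f rho CF lambda0_min ukh1 ukh y) <=
    energy_norm A0 (ukh - ueps).
Proof.
have e0 := elliptic_ge0 (ltW hlambda0_min) hell_0.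
have e1 := elliptic_ge0 (ltW hlambdaeps_min) hell_eps.
have /andP[rho0 rho_lt] := hrho.
have contr := iteration_contraction hlambda0_min hA0 hell_0 hAeps e1 hf hlower hupper
  (ltW rho0) hukh hu hueps hueps_sol hu_sol.
rewrite -hq in contr.
have l01 : 0 < lambda0_min <= 1 by rewrite hlambda0_min.
have maj := majorant_bound l01 hA0 hell_0 hAeps e1 hf hCF hukh hukh1 hu hy hu_sol.
have [v2 v12 u2 ue2] := And4 (H10_L2vec hukh) (H10_L2vec hukh1) (H10_L2vec hu)
  (H10_L2vec hueps).
have t1 := energy_norm_triangle hA0 e0 v2 ue2 v12.
have t2 := energy_norm_triangle hA0 e0 v12 ue2 u2.
have t3 := energy_norm_triangle hA0 e0 v12 v2 u2.
have t4 := energy_norm_triangle hA0 e0 u2 v2 ue2.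
rewrite (energy_norm_subC _ ukh ukh1) in t1.
rewrite (energy_norm_subC _ ueps ukh) in t4.
have q0 : 0 <= q by rewrite hq sqrtr_ge0.
have q1 : q < 1.
  (* The radicand falls short of 1 by rho (2 lambda1 - rho cmax), positive because rho < 2 lambda1 /
     cmax. *)
  rewrite hq -[ltRHS]sqrtr1 ltr_sqrt//.
  rewrite -subr_gt0 (_ : _ - _ = rho * (2 * lambda1 - rho * cmax)); last by ring.
  by rewrite mulr_gt0// subr_gt0 -ltr_pdivlMr.
exact: (error_two_sided q0 q1 t1 t2 t3 t4 contr maj).
Qed.
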